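(* Let $\mathcal{C}$ be a covering of $\mathbb{Z}^2$ which is a refinement of the trivial covering $\{\mathbb{Z}^2\}$, and let $N=\operatorname{lcm}(\mathcal{C})$. Then $$|\mathcal{C}|\ge 1+G(N).$$ Equality holds if and only if, in the construction of $\mathcal{C}$ from the trivial covering by successive $p$-refinements (for various primes $p$), every $p$-refinement was applied to a lattice $L$ whose index had maximal $p$-valuation, i.e. $\operatorname{ord}_p([\mathbb{Z}^2:L])=\max_{L'}\operatorname{ord}_p([\mathbb{Z}^2:L'])$, where $L'$ runs over the lattices in the covering to which that $p$-refinement step was applied.
   Context: A lattice is a subgroup of $\mathbb{Z}^2$ of finite index; it is cocyclic if $\mathbb{Z}^2/L$ is cyclic. A covering (of $\mathbb{Z}^2$) is a finite collection (set) $\mathcal{C}$ of lattices whose union is $\mathbb{Z}^2$. The index lcm of $\mathcal{C}$ is $\operatorname{lcm}(\mathcal{C})=\operatorname{lcm}\{[\mathbb{Z}^2:L] : L\in\mathcal{C}\}$. For a prime $p$, the $p$-descendants of a cocyclic lattice $L$ are the cocyclic lattices $L'\subseteq L$ with $[L:L']=p$ (there are $p$ of them if $p\mid[\mathbb{Z}^2:L]$ and $p+1$ otherwise). A $p$-refinement of a covering by cocyclic lattices is obtained by replacing one lattice in it by all of its $p$-descendants; a refinement is any covering obtained by a finite sequence (possibly empty) of $p$-refinements, the prime $p$ being allowed to vary from step to step. The arithmetic function $G$ is defined, for $N=\prod_{i=1}^m p_i^{e_i}$ with distinct primes $p_i$ and $e_i\ge1$, by $G(N)=\sum_{i=1}^m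 (e_i(p_i-1)+1)$, with $G(1)=0$. *)

(* Defs.v *)
From mathcomp Require Import all_boot all_order all_algebra.
From mathcomp Require Import finmap boolp classical_sets functions cardinality.

Set Implicit Arguments.
Unset Strict Implicit.
Unset Printing Implicit Defensive.

Import Order.TTheory GRing.Theory Num.Theory.

Local Open Scope classical_set_scope.
Local Open Scope ring_scope.

Notation Z2 := (int * int)%type.

Definition is_subgroup (L : set Z2) : Prop :=
  L 0 /\ forall x y, L x -> L y -> L (x - y).

Definition coset (L : set Z2) (x : Z2) : set Z2 := [set x + y | y in L].

(* The quotient group H / L, for L a subgroup of H. *)
Definition cosets (H L : set Z2) : set (set Z2) := [set coset L x | x in H].

(* [H : L]; the value is 0 when the index is infinite. *)
Definition subgroup_index (H L : set Z2) : nat := #|` fset_set (cosets H L)|%fset.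

Definition is_lattice (L : set Z2) : Prop :=
  is_subgroup L /\ finite_set (cosets setT L).

(* The coset of g generates the quotient Z^2 / L. *)
Definition cocyclic (L : set Z2) : Prop :=
  exists g : Z2, forall x : Z2, exists k : int, coset L x = coset L (g *~ k).

Definition is_covering (C : {fset set Z2}) : Prop :=
  (forall L, L \in C -> is_lattice L) /\
  \bigcup_(L in [set` C]) L = [set: Z2].

Definition lcm_index (C : {fset set Z2}) : nat :=
  \big[lcmn/1%N]_(L <- C) subgroup_index setT L.

Definition trivial_covering : {fset set Z2} := [fset [set: Z2]]%fset.

Definition descendants (p : nat) (L : set Z2) : set (set Z2) :=
  [set L' | [/\ is_lattice L', cocyclic L', L' `<=` L & subgroup_index L L' = p]].

Definition is_p_refinement (p : nat) (L : set Z2) (C D : {fset set Z2}) : Prop :=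
  [/\ prime p, L \in C & [set` D] = ([set` C] `\ L) `|` descendants p L].

(* A step (C, p, L) is the p-refinement of the covering C at the lattice L. *)
Notation step := ({fset set Z2} * nat * set Z2)%type.

Inductive construction (C : {fset set Z2}) :
    seq step -> {fset set Z2} -> Prop :=
| construction_nil : construction C [::] C
| construction_rcons s D p L D' :
    construction C s D -> is_p_refinement p L D D' ->
    construction C (rcons s (D, p, L)) D'.

Definition is_refinement (C D : {fset set Z2}) : Prop :=
  exists s, construction C s D.

Definition maximal_step (t : step) : Prop :=
  let: (C, p, L) := t in
  logn p (subgroup_index setT L) = (\max_(L' <- C) logn p (subgroup_index setT L'))%N.

Definition G (N : nat) : nat :=
  (\sum_(p <- primes N) (logn p N * (p - 1) + 1))%N.

(* Main.v *)
(* A cocyclic lattice of index n is {z | n divides u.z} for an integral form u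
   surjective modulo n, and a primitive vector lies in exactly one cocyclic
   lattice of each index; so the lattices of a refinement share no primitive
   vectors, and a p-refinement at L raises the cardinality by exactly p or p - 1,
   according to whether p divides the index of L.  If L has maximal p-valuation,
   the index lcm N is multiplied by p and G(N) grows by the same amount;
   otherwise N is unchanged while the cardinality strictly increases. *)
Require Import Defs.
From mathcomp Require Import all_boot all_order all_algebra.
From mathcomp Require Import finmap boolp classical_sets functions cardinality.
From mathcomp Require Import zify ring.

Set Implicit Arguments.
Unset Strict Implicit.
Unset Printing Implicit Defensive.

Import Order.TTheory GRing.Theory Num.Theory.

Local Open Scope classical_set_scope.
Local Open Scope ring_scope.

(** * Integral linear forms, subgroups and cosets of Z^2 *)

Definition form (u z : Z2) : int := u.1 * z.1 + u.2 * z.2.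

(** Surjectivity of the form modulo n is not built in: it enters later as a witness [g] with
    [form u g] congruent to 1, and the coset of [g] then generates the quotient. *)
Definition congr_lattice (u : Z2) (n : int) : set Z2 :=
  [set z | (n %| form u z)%Z].

Lemma Z2_mulrz (z : Z2) (k : int) : z *~ k = (z.1 * k, z.2 * k).
Proof.
have natE (n : nat) : z *+ n = (z.1 * n, z.2 * n).
  elim: n => [|n IH]; first by rewrite mulr0n !mulr0.
  rewrite mulrS IH; congr pair; rewrite /= -add1n PoszD; ring.
case: k => n; rewrite ?NegzE; first exact: natE.
by rewrite mulrNz -pmulrn natE !mulrN.
Qed.

Lemma formB (u x y : Z2) : form u (x - y) = form u x - form u y.
Proof. by rewrite /form /=; ring. Qed.

Lemma formD (u x y : Z2) : form u (x + y) = form u x + form u y.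
Proof. by rewrite /form /=; ring. Qed.

Lemma formMz (u x : Z2) (k : int) : form u (x *~ k) = form u x * k.
Proof. by rewrite Z2_mulrz /form /=; ring. Qed.

Lemma form_addl (u v x : Z2) : form (u + v) x = form u x + form v x.
Proof. by rewrite /form /=; ring. Qed.

Lemma form_oppl (u x : Z2) : form (- u) x = - form u x.
Proof. by rewrite /form /=; ring. Qed.

Lemma form_mulzl (u x : Z2) (k : int) : form (u *~ k) x = form u x * k.
Proof. by rewrite Z2_mulrz /form /=; ring. Qed.

Definition formE := (formB, form_oppl, formD, form_addl, formMz, form_mulzl).

Lemma subgroupN (L : set Z2) x : is_subgroup L -> L x -> L (- x).
Proof. by move=> [L0 LB] Lx; rewrite -[- x]add0r; apply: LB. Qed.

Lemma subgroupD (L : set Z2) x y : is_subgroup L -> L x -> L y -> L (x + y).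
Proof.
by move=> sL Lx Ly; rewrite -[y]opprK; apply: sL.2 => //; apply: subgroupN.
Qed.

Lemma coset_eq (L : set Z2) (x y : Z2) :
  is_subgroup L -> coset L x = coset L y <-> L (x - y).
Proof.
move=> sL; split=> [eqxy|Lxy].
  have : coset L x x by exists 0; [exact: sL.1|rewrite addr0].
  by rewrite eqxy => -[z Lz <-]; rewrite addrAC subrr add0r.
apply/seteqP; split=> z [t Lt <-].
  exists (x - y + t); first exact: subgroupD.
  by rewrite addrA addrC [y + _]addrC subrK addrC.
exists (y - x + t); last by rewrite addrA [x + _]addrC subrK.
by apply: subgroupD => //; rewrite -opprB; apply: subgroupN.
Qed.

(** * Congruence lattices and their indices *)

Lemma congr_lattice_subgroup (u : Z2) (n : int) : is_subgroup (congr_lattice u n).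
Proof.
split; first by rewrite /congr_lattice /= /form /= !mulr0 addr0 dvdz0.
by move=> x y; rewrite /congr_lattice /= formB; apply: rpredB.
Qed.

Lemma congr_lattice1 (u : Z2) : congr_lattice u 1 = setT.
Proof. by apply/seteqP; split=> // z _; rewrite /congr_lattice /= dvd1z. Qed.

(** The generator is the least positive element of [S], which exists thanks to [m]; the remainder of
    any element modulo it is again in [S], hence zero. *)
Lemma int_subgroup (S : int -> Prop) (m : nat) :
  S 0 -> (forall a b, S a -> S b -> S (a - b)) -> (0 < m)%N -> S m ->
  exists n : nat, (0 < n)%N /\ forall k, S k <-> (n %| k)%Z.
Proof.
move=> S0 SB m0 Sm.
have [n /andP[n0 /asboolP Sn] minn] :=
  find_ex_minn (P := fun n => (0 < n)%N && `[< S n >])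
    (ex_intro _ m (introT andP (conj m0 (introT (asboolP _) Sm)))).
have SN a : S a -> S (- a) by move=> Sa; rewrite -[- a]add0r; apply: SB.
have SM (a : int) : S (n%:Z * a).
  have Snat (i : nat) : S (n%:Z * i).
    elim: i => [|i IH]; first by rewrite mulr0.
    by have := SB _ _ IH (SN _ Sn); congr S; lia.
  case: a => [i|i]; first exact: Snat.
  by rewrite NegzE mulrN; apply: SN; apply: Snat.
exists n; split=> // k; split=> [Sk|/dvdzP[q ->]]; last by rewrite mulrC.
have nz : n%:Z != 0 by lia.
have Sr : S (k %% n)%Z.
  by rewrite /modz mulrC; apply: SB.
have n0z : 0 < n%:Z by [].
apply/dvdz_mod0P; have := modz_ge0 k nz; have := ltz_pmod k n0z; move: Sr.
case: (k %% n)%Z => // -[//|r] Sr ltr _.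
have := minn r.+1; rewrite /= (introT (asboolP _) Sr) => /(_ isT).
by have := ltr; lia.
Qed.

(* The quotient of the two congruence lattices is cyclic of order k, generated
   by the coset of [g *~ d]. *)
Lemma cosets_congr_lattice (u g : Z2) (d k : nat) :
  (0 < d * k)%N -> ((d * k)%:Z %| form u g - 1)%Z ->
  (cosets (congr_lattice u d) (congr_lattice u (d * k)%N) #= `I_k)%card.
Proof.
move=> dk0 /dvdzP[q Dq].
have [d0 k0] : (0 < d)%N /\ (0 < k)%N by move: dk0; rewrite muln_gt0 => /andP.
set L := congr_lattice u (d * k)%N.
have sL : is_subgroup L by apply: congr_lattice_subgroup.
have gE : form u g = q * (d * k)%:Z + 1 by lia.
suff -> : cosets (congr_lattice u d) L =
          [set coset L (g *~ (d * i)%N) | i in `I_k].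
  (* Applying the form, equal cosets give d i = d j modulo d k, so k divides i - j. *)
  apply: inj_card_eq => i j.
  rewrite !inE /= => ik jk /(coset_eq _ _ sL).
  rewrite /L /congr_lattice /= !formE gE => /dvdzP[r Dr].
  have {Dr} /eqP : (d%:Z * (i%:Z - j%:Z)) = d%:Z * ((r - q * d * (i%:Z - j%:Z)) * k).
    transitivity (r * (d * k)%N%:Z - q * (d * k)%N%:Z * ((d * i)%N%:Z - (d * j)%N%:Z)).
      by rewrite -Dr; lia.
    by lia.
  rewrite (inj_eq (mulfI _)); last by lia.
  move=> /eqP; set s := (r - _) => Ds.
  have : s = 0 by nia.
  by move=> s0; lia.
apply/seteqP; split=> C [].
  (* If the form takes the value y d at x, the representative i is y modulo k. *)
  move=> x Lx <-; case/dvdzP: Lx => y Dy.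
  have kz : k%:Z != 0 by lia.
  have := modz_ge0 y kz; have := ltz_pmod y (_ : 0 < k%:Z).
  have := divz_eq y k; case: (y %% k)%Z => // i Di ltk _.
  exists i; first by have := ltk; rewrite /=; lia.
  apply/(coset_eq _ _ sL); rewrite /L /congr_lattice /= !formE gE Dy Di.
  apply/dvdzP; exists (q * (d * i)%N - (y %/ k)%Z).
  by rewrite !PoszM; ring.
move=> i ik <-; exists (g *~ (d * i)%N) => //.
rewrite /congr_lattice /= formE gE; apply/dvdzP.
by exists ((q * (d * k)%:Z + 1) * i); rewrite !PoszM; ring.
Qed.

Lemma index_congr_lattice (u g : Z2) (d k : nat) :
  (0 < d * k)%N -> ((d * k)%:Z %| form u g - 1)%Z ->
  subgroup_index (congr_lattice u d) (congr_lattice u (d * k)%N) = k.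
Proof. by move=> dk0 ug; apply/card_fset_set/(cosets_congr_lattice dk0 ug). Qed.

Lemma index_congr_lattice_setT (u g : Z2) (n : nat) :
  (0 < n)%N -> (n %| form u g - 1)%Z ->
  subgroup_index setT (congr_lattice u n) = n.
Proof.
move=> n0 ug; rewrite -(congr_lattice1 u).
by have := @index_congr_lattice u g 1 n; rewrite mul1n; apply.
Qed.

Lemma congr_lattice_is_lattice (u g : Z2) (n : nat) :
  (0 < n)%N -> (n %| form u g - 1)%Z -> is_lattice (congr_lattice u n).
Proof.
move=> n0 ug; split; first exact: congr_lattice_subgroup.
apply/finite_setP; exists n; rewrite -(congr_lattice1 u).
by have := @cosets_congr_lattice u g 1 n; rewrite mul1n; apply.
Qed.

Lemma congr_lattice_cocyclic (u g : Z2) (n : int) :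
  (n %| form u g - 1)%Z -> cocyclic (congr_lattice u n).
Proof.
move=> ug; exists g => x; exists (form u x).
apply/coset_eq; first exact: congr_lattice_subgroup.
rewrite /congr_lattice /= formB formMz.
by rewrite -opprB -[X in _ - X]mul1r -mulrBl rpredN dvdz_mulr.
Qed.

(** * Cocyclic lattices are congruence lattices *)

(** Modulo [L] every x equals g times [form w x], so membership depends only on [form w x], and the
    k with [g *~ k] in [L] form an ideal nZ. Since [w] is given in advance, a lattice and a
    sublattice can share one form. *)
Lemma subgroup_eq_congr_lattice (L : set Z2) (w g : Z2) (m : nat) :
  is_subgroup L -> (forall x, L (x - g *~ form w x)) ->
  (0 < m)%N -> L (g *~ m) ->
  exists n : nat, [/\ (0 < n)%N, (n %| m)%N, (n %| form w g - 1)%Z &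
    L = congr_lattice w n].
Proof.
move=> sL LP m0 Lm.
have [||n [n0 nP]] := @int_subgroup (fun k => L (g *~ k)) m _ _ m0 Lm.
- by rewrite mulr0z; exact: sL.1.
- by move=> a b La Lb; rewrite mulrzBr; apply: sL.2.
exists n; split=> //; first by have /nP := Lm.
  have := LP g; rewrite -{1}[g]mulr1z -mulrzBr nP.
  by rewrite -opprB rpredN.
apply/seteqP; split=> x; rewrite /congr_lattice /= -nP => Lx.
  have := sL.2 _ _ Lx (LP x); congr L.
  by rewrite opprB addrC subrK.
by have := subgroupD sL Lx (LP x); rewrite addrC subrK.
Qed.

(** If g generates the quotient and the unit vectors are congruent to a g and b g, then x is
    congruent to g times the value of the form (a, b) at x. *)
Lemma cocyclic_congr_lattice (L : set Z2) : is_lattice L -> cocyclic L ->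
  exists u g (n : nat),
    [/\ (0 < n)%N, (n %| form u g - 1)%Z & L = congr_lattice u n].
Proof.
move=> [sL finL] [g gP].
have {}gP x : exists k : int, L (x - g *~ k).
  by have [k] := gP x; rewrite coset_eq //; exists k.
(* The quotient is finite, so two multiples of [g] share a coset; their difference gives a positive
   multiple in [L]. *)
have [m m0 Lm] : exists2 m : nat, (0 < m)%N & L (g *~ m).
  apply: contrapT => noL; apply: infinite_nat.
  pose f (i : nat) := coset L (g *~ i).
  have -> : [set: nat] = f @^-1` cosets setT L.
    by apply/seteqP; split=> // i _; exists (g *~ i).
  apply: finite_preimage finL => i j _ _ /(coset_eq _ _ sL).
  rewrite -mulrzBr; case: (ltngtP i j) => // ij Lij.
    have := subgroupN sL Lij; rewrite -mulrNz opprB subzn; last exact: ltnW.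
    by move=> Lji; case: noL; exists (j - i)%N; rewrite // subn_gt0.
  by case: noL; exists (i - j)%N; rewrite ?subn_gt0 // -subzn // ltnW.
have [a La] := gP (1, 0); have [b Lb] := gP (0, 1).
have LM x k : L x -> L (x *~ k).
  move=> Lx; case: k => i; rewrite ?NegzE ?mulrNz; last apply: subgroupN => //.
    elim: i => [|i IH]; first exact: sL.1.
    by rewrite -pmulrn mulrS; apply: subgroupD.
  elim: i.+1 => [|{}i IH]; first exact: sL.1.
  by rewrite -pmulrn mulrS; apply: subgroupD.
have LP x : L (x - g *~ form (a, b) x).
  have := subgroupD sL (LM _ x.1 La) (LM _ x.2 Lb); congr L.
  by rewrite !Z2_mulrz /form; case: x => x1 x2 /=; congr pair; rewrite /=; ring.
have [n [n0 _ ng DL]] := subgroup_eq_congr_lattice sL LP m0 Lm.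
by exists (a, b), g, n.
Qed.

(** * Adapted bases and the descendants of a cocyclic lattice *)

Lemma dvdz_mul_inv (N c z y : int) :
  (N %| c * z - 1)%Z -> (N %| c * y)%Z = (N %| y)%Z.
Proof.
move=> Ncz; apply/idP/idP => [Ncy|]; last exact: dvdz_mull.
have -> : y = z * (c * y) - (c * z - 1) * y by ring.
by apply: rpredB; [apply: dvdz_mull|apply: dvdz_mulr].
Qed.

(* [u'], [v] are the coordinates of Z^2 with respect to the basis [f], [e]. *)
Lemma congr_lattice_basis (u g : Z2) (n : nat) : (n %| form u g - 1)%Z ->
  exists u' v e f : Z2,
    [/\ form u' f = 1, form v e = 1, form v f = 0 /\ form u' e = 0,
        forall w x, form w x = form w e * form v x + form w f * form u' x &
        congr_lattice u n = congr_lattice u' n].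
Proof.
case: u => u1 u2 ug.
(* Dividing [u] by the gcd c of its entries leaves a primitive form (a, b); c is a unit modulo n
   because [u] is surjective modulo n. *)
suff [a [b [s [t [c [-> -> sat /dvdz_mul_inv Dc]]]]]] : exists a b s t c,
    [/\ u1 = a * c, u2 = b * c, s * a + t * b = 1 &
        (n %| c * form (a, b) g - 1)%Z].
  exists (a, b), (- t, s), (- b, a), (s, t).
  split; rewrite /form /=; [lia|lia|split; ring| |].
    move=> w x.
    rewrite -[w.1 * x.1 + _](mulr1) -sat; ring.
  have D x : (n %| form (a * c, b * c) x)%Z = (n %| form (a, b) x)%Z.
    by rewrite -[RHS]Dc; congr (_ \in dvdz _); rewrite /form /=; ring.
  by apply/seteqP; split=> x; rewrite /congr_lattice /= D.
have [s [t Dc]] := Bezoutz u1 u2.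
case: (eqVneq (gcdz u1 u2) 0) => [c0|c0].
  move/eqP: c0; rewrite gcdz_eq0 => /andP[/eqP u10 /eqP u20].
  (* The zero form is surjective only modulo 1, where any primitive form will do. *)
  exists 1, 0, 1, 0, 0; split; rewrite ?u10 ?u20 //=.
  by move: ug; rewrite /form u10 u20 /= !mul0r.
have /dvdzP[a Da] := dvdz_gcdl u1 u2; have /dvdzP[b Db] := dvdz_gcdr u1 u2.
exists a, b, s, t, (gcdz u1 u2); move: (gcdz u1 u2) c0 Dc Da Db => c c0 Dc Da Db.
split=> //; first by apply: (mulIf c0); rewrite mul1r -[RHS]Dc Da Db; ring.
by move: ug; congr (is_true (_ \in dvdz _)); rewrite /form /= Da Db; ring.
Qed.

Lemma sub_form_congr_lattice (w g x : Z2) (m : int) :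
  (m %| form w g - 1)%Z -> congr_lattice w m (x - g *~ form w x).
Proof.
rewrite /congr_lattice /= formB formMz => mg.
by rewrite -opprB -[X in _ - X]mul1r -mulrBl rpredN dvdz_mulr.
Qed.

(** One form serves both lattices: a form for [L'] also presents [L], by
    [subgroup_eq_congr_lattice], and comparing indices fixes the moduli. *)
Lemma descendants_congr_lattice (p : nat) (L L' : set Z2)
    (n := subgroup_index setT L) :
  is_subgroup L -> (0 < n)%N -> (0 < p)%N ->
  descendants p L L' <-> exists w g,
    [/\ ((n * p)%N %| form w g - 1)%Z, L' = congr_lattice w (n * p)%N &
        L = congr_lattice w n].
Proof.
move=> sL n0 p0; split.
  case=> latL' cocL' sub ind.
  have [w [g [m [m0 wg DL']]]] := cocyclic_congr_lattice latL' cocL'.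
  have [||d [d0 dm wgd DL]] := @subgroup_eq_congr_lattice L w g m sL _ m0.
  - by move=> x; apply: sub; rewrite DL'; apply: sub_form_congr_lattice.
  - by apply: sub; rewrite DL' /congr_lattice /= formMz dvdz_mull.
  have Dd : d = n by rewrite /n DL (index_congr_lattice_setT d0 wgd).
  have /dvdnP[k Dm] := dm.
  rewrite mulnC in Dm.
  have Dk : k = p by rewrite -ind DL DL' Dm (@index_congr_lattice _ g) // -Dm.
  by exists w, g; rewrite -Dd -Dk -Dm.
case=> w [g [wg DL' DL]]; have np0 : (0 < n * p)%N by rewrite muln_gt0 n0.
split.
- by rewrite DL'; apply: congr_lattice_is_lattice wg.
- by rewrite DL'; apply: congr_lattice_cocyclic wg.
- rewrite DL DL' => x; rewrite /congr_lattice /=; apply: dvdz_trans.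
  by rewrite PoszM dvdz_mulr.
by rewrite {1}DL DL' (index_congr_lattice np0 wg).
Qed.

Lemma prime_bezoutz (p : nat) (c : int) : prime p -> ~~ (p %| c)%Z ->
  exists a b : int, a * c + b * p = 1.
Proof.
move=> p_pr; rewrite dvdzE /= -prime_coprime // => cop.
have /coprimezP[[b a] /= ab] : coprimez p c by [].
by exists a, b; rewrite addrC.
Qed.

(** Splits a congruence modulo n p into one modulo n and one modulo p. The last hypothesis stands in
    for the invertibility of p b modulo n. *)
Lemma dvdz_mul_combination (p : nat) (n a b X Y : int) : prime p -> n != 0 ->
  ~~ (p %| a)%Z -> ((n %| n * a * X + p%:Z * b * Y)%Z -> (n %| Y)%Z) ->
  (n * p%:Z %| n * a * X + p%:Z * b * Y)%Z = (n %| Y)%Z && (p %| X)%Z.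
Proof.
move=> p_pr n0 pa nY; apply/idP/andP => [npXY|[/dvdzP[q ->] /dvdzP[r ->]]].
  have /nY nY' : (n %| n * a * X + p%:Z * b * Y)%Z.
    by apply: dvdz_trans npXY; apply: dvdz_mulr.
  split=> //.
  have : (n * p%:Z %| n * (a * X))%Z.
    have -> : n * (a * X) = n * a * X + p%:Z * b * Y - p%:Z * b * Y by ring.
    apply: rpredB => //; case/dvdzP: nY' => q ->.
    by apply/dvdzP; exists (q * b); ring.
  by rewrite dvdz_mul2l // !dvdzE abszM Euclid_dvdM // -!dvdzE (negPf pa).
by apply/dvdzP; exists (a * r + b * q); ring.
Qed.

(** The candidates form a projective line over F_p: p affine points [D k], and a point at infinity
    where n divides u and p divides v, which is cocyclic only if p does not divide n. *)
Lemma descendants_seq (p : nat) (L : set Z2) (n := subgroup_index setT L) :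
  is_lattice L -> cocyclic L -> prime p ->
  exists s : seq (set Z2),
    [/\ uniq s, size s = (p + ~~ (p %| n))%N &
        forall L', descendants p L L' <-> L' \in s].
Proof.
move=> latL cocL p_pr; have p0 := prime_gt0 p_pr.
have [u0 [g0 [n' [n0 ug DL]]]] := cocyclic_congr_lattice latL cocL.
have Dn : n' = n by rewrite /n DL (index_congr_lattice_setT n0 ug).
have [u [v [e [f [uf ve [vf ue] wE]]]]] := congr_lattice_basis ug.
rewrite -{}DL => {ug} DL; move: n0 DL; rewrite {}Dn => n0 DL.
pose D (k : nat) := congr_lattice (u - v *~ (n * k)%N) (n * p)%N.
have DE k x : D k x = ((n * p)%N %| form u x - form v x * (n * k)%N)%Z.
  by rewrite /D /congr_lattice /= !formE.
have npz : n%:Z != 0 by rewrite eqz_nat -lt0n.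
have eqLu (w : Z2) : (forall x, (n %| form w x)%Z = (n %| form u x)%Z) ->
    L = congr_lattice w n.
  move=> wu; rewrite DL.
  by apply/seteqP; split=> x; rewrite /congr_lattice /= wu.
have descP := descendants_congr_lattice _ latL.1 n0 p0.
have D_desc k : descendants p L (D k).
  apply/descP; exists (u - v *~ (n * k)%N), f; split=> //.
    by rewrite !formE uf vf mul0r subr0 subrr dvdz0.
  apply: eqLu => x; rewrite !formE rpredDr //.
  by rewrite PoszM rpredN mulrCA dvdz_mulr.
(* The vector e + n k f recovers k modulo p, so the [D k] with k < p are distinct. *)
have D_mem k k' : D k' (e + f *~ (n * k)%N) = (p %| k%:Z - k'%:Z)%Z :> Prop.
  rewrite DE !formE ue uf ve vf !(mul1r, mul0r, add0r, addr0) !PoszM -mulrBr.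
  by rewrite dvdz_mul2l.
have D_uniq : uniq [seq D k | k <- iota 0 p].
  rewrite map_inj_in_uniq ?iota_uniq // => k k'; rewrite !mem_iota /= => kp k'p DD.
  have := D_mem k k'; rewrite -DD D_mem subrr dvdz0 => /esym E.
  have /dvdzP[q Dq] : (p %| k%:Z - k'%:Z)%Z by rewrite E.
  have q0 : q = 0 by nia.
  by lia.
have D_complete (w g : Z2) : ((n * p)%N %| form w g - 1)%Z ->
    L = congr_lattice w n -> ~~ (p %| form w f)%Z ->
    congr_lattice w (n * p)%N \in [seq D k | k <- iota 0 p].
  move=> wg DLw pwf.
  have /dvdzP[a Da] : (n %| form w e)%Z.
    have : L e by rewrite DL /congr_lattice /= ue dvdz0.
    by rewrite DLw.
  have [s [t st]] := prime_bezoutz p_pr pwf.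
  have pz : p%:Z != 0 by rewrite eqz_nat -lt0n.
  have pz0 : 0 < p%:Z by [].
  (* Here [s] inverts w(f) modulo p. With this k, w is w(f) times the form of [D k] modulo n p. *)
  have [k kp /dvdzP[q Dq]] : exists2 k : nat, (k < p)%N & (p %| a + form w f * k%:Z)%Z.
    exists `|((- a * s) %% p)%Z|%N.
      by have := modz_ge0 (- a * s) pz; have := ltz_pmod (- a * s) pz0; lia.
    rewrite gez0_abs ?modz_ge0 // /modz.
    apply/dvdzP; exists (a * t - form w f * ((- a * s) %/ p)%Z).
    rewrite -[X in X + _]mulr1 -{1}st; ring.
  suff -> : congr_lattice w (n * p)%N = D k.
    by apply/mapP; exists k; rewrite ?mem_iota.
  have wE' x : form w x = form w f * (form u x - form v x * (n * k)%N) +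
      q * form v x * (n * p)%N.
    have -> : q * form v x * (n * p)%N = (a + form w f * k) * (n%:Z * form v x).
      by rewrite Dq !PoszM; ring.
    by rewrite wE Da !PoszM; ring.
  have wD x : ((n * p)%N %| form w x)%Z =
      ((n * p)%N %| form u x - form v x * (n * k)%N)%Z.
    rewrite wE' rpredDr; last exact: dvdz_mull.
    rewrite (@dvdz_mul_inv _ _ (form u g - form v g * (n * k)%N)) //.
    by move: wg; rewrite wE' addrAC rpredDr // dvdz_mull.
  by apply/seteqP; split=> x; rewrite DE -wD.
have D_inf (w g : Z2) : ((n * p)%N %| form w g - 1)%Z ->
    L = congr_lattice w n -> (p %| form w f)%Z ->
    ~~ (p %| n)%N /\ congr_lattice w (n * p)%N =
    [set x | (n %| form u x)%Z && (p %| form v x)%Z].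
  move=> wg DLw /dvdzP[b Db].
  have /dvdzP[a Da] : (n %| form w e)%Z.
    have : L e by rewrite DL /congr_lattice /= ue dvdz0.
    by rewrite DLw.
  (* Since p divides w(f) and w is surjective modulo p, w(e) = n a is prime to p. *)
  have gE : ~~ (p %| n%:Z * a)%Z.
    apply/negP => pna; move: wg; rewrite wE => wg.
    have : (p %| form w e * form v g + form w f * form u g - 1)%Z.
      by apply: dvdz_trans wg; rewrite PoszM dvdz_mull.
    rewrite rpredDl; first by rewrite rpredN dvdz1 /= gtn_eqF // prime_gt1.
    by rewrite rpredD // ?Da ?Db ?[_ * n%:Z]mulrC dvdz_mulr // dvdz_mull.
  split; first by apply: contra gE => pn; rewrite dvdz_mulr.
  have pa : ~~ (p %| a)%Z by apply: contra gE => pa; rewrite dvdz_mull.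
  have wu x : (n %| form w x)%Z = (n %| form u x)%Z.
    have : congr_lattice w n x <-> congr_lattice u n x by rewrite -DLw -DL.
    by move=> [wu uw]; apply/idP/idP.
  have wx x : ((n * p)%N %| form w x)%Z = (n %| form u x)%Z && (p %| form v x)%Z.
    have E : form w x = n%:Z * a * form v x + p%:Z * b * form u x.
      by rewrite wE Da Db; ring.
    by rewrite PoszM E dvdz_mul_combination // -E wu.
  by apply/seteqP; split=> x; rewrite /congr_lattice /= wx.
exists ([seq D k | k <- iota 0 p] ++
  (if (p %| n)%N then [::] else [:: [set x | (n %| form u x)%Z && (p %| form v x)%Z]])).
split.
- rewrite cat_uniq D_uniq /=; case: ifP => //= pn; rewrite orbF andbT.
  apply/negP => /mapP[k _ Dk].
  have : D k (e + f *~ (n * k)%N) by rewrite D_mem subrr dvdz0.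
  rewrite -Dk /= !formE ve vf mul0r addr0 dvdz1 /= => /andP[_].
  by rewrite gtn_eqF // prime_gt1.
- by rewrite size_cat size_map size_iota; case: ifP.
move=> L'; split=> [/descP[w [g [wg -> DLw]]]|].
  rewrite mem_cat; apply/orP.
  case: (boolP (p %| form w f)%Z) => [pwf|]; last by left; apply: D_complete wg DLw _.
  by right; have [/negPf -> ->] := D_inf w g wg DLw pwf; rewrite mem_seq1.
rewrite mem_cat => /orP[/mapP[k _ ->]|]; first exact: D_desc.
case: ifPn => // pn; rewrite inE => /eqP ->.
have [a [b ab]] : exists a b : int, a * n%:Z + b * p%:Z = 1 by apply: prime_bezoutz.
(* Chinese remainder: w is u modulo n and v modulo p, so it presents the point at infinity. *)
pose w := u *~ (b * p) + v *~ (a * n).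
have wg : ((n * p)%N %| form w (e + f) - 1)%Z.
  by rewrite /w !formE ue uf ve vf !(mul0r, addr0, add0r, mul1r) ab subrr dvdz0.
have DLw : L = congr_lattice w n.
  apply: eqLu => x; rewrite /w !formE rpredDr; last by rewrite mulrA dvdz_mull.
  rewrite mulrC (@dvdz_mul_inv _ _ 1) //.
  have -> : b * p%:Z * 1 - 1 = - a * n%:Z by rewrite mulr1 -ab; ring.
  exact: dvdz_mull.
apply/descP; exists w, (e + f); split=> //.
by apply/esym; apply: (D_inf w (e + f) wg DLw _).2; 
  rewrite /w !formE uf vf mul0r addr0 mul1r dvdz_mull.
Qed.

(** * Lattices determined by a primitive vector and an index *)

(** The form (- z.2, z.1) is the determinant against z. As u vanishes at the primitive vector z
    modulo N, it is a unit times this determinant modulo N, so the lattice depends only on z and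
    N. *)
Lemma congr_lattice_primitive (u g c z : Z2) (N : int) :
  form c z = 1 -> (N %| form u g - 1)%Z -> (N %| form u z)%Z ->
  congr_lattice u N = congr_lattice (- z.2, z.1) N.
Proof.
move=> cz ug uz.
have E x : form u x = (c.1 * x.1 + c.2 * x.2) * form u z +
    form u (- c.2, c.1) * form (- z.2, z.1) x.
  by rewrite -[LHS]mulr1 -cz /form /=; ring.
have D x : (N %| form u x)%Z =
    (N %| form u (- c.2, c.1) * form (- z.2, z.1) x)%Z.
  by rewrite E rpredDl // dvdz_mull.
apply/seteqP; split=> x; rewrite /congr_lattice /= D (dvdz_mul_inv (z := form (- z.2, z.1) g)) //;
  by move: ug; rewrite E -addrA rpredDl // dvdz_mull.
Qed.

(** * The function [G] and least common multiples *)

Lemma G_mul_prime (p N : nat) : prime p -> (0 < N)%N ->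
  G (p * N) = (G N + (p - 1) + ~~ (p %| N))%N.
Proof.
move=> p_pr N0; have p0 := prime_gt0 p_pr.
have lE q : logn q (p * N) = ((q == p) + logn q N)%N.
  by rewrite lognM // logn_prime // eq_sym.
have mE q : (q \in primes (p * N)) = (q == p) || (q \in primes N).
  by rewrite primesM // primes_prime // inE.
have pN : (p \in primes N) = (p %| N)%N by rewrite mem_primes p_pr N0.
(* Along a duplicate-free list, raising the exponent of p by one adds p - 1 if p is listed and
   nothing otherwise. *)
have GE : forall s : seq nat, uniq s ->
    (\sum_(q <- s) (((q == p) + logn q N) * (q - 1) + 1) =
     \sum_(q <- s) (logn q N * (q - 1) + 1) + (p \in s) * (p - 1))%N.
  elim=> [|q s IH] /=; first by rewrite !big_nil.
  move=> /andP[qs /IH E]; rewrite !big_cons E inE [p == q]eq_sym.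
  case: eqP qs => [->|_] qs /=; last by rewrite add0n addnA.
  by rewrite (negPf qs); lia.
rewrite /G (eq_bigr _ (fun q _ => congr1 (fun l => l * (q - 1) + 1)%N (lE q))).
case: (boolP (p %| N)%N) => pdN.
  rewrite (perm_big (primes N)); last first.
    apply: uniq_perm; rewrite ?primes_uniq // => q; rewrite mE.
    by case: eqP => // ->; rewrite pN.
  by rewrite GE ?primes_uniq // pN pdN mul1n addn0.
rewrite (perm_big (p :: primes N)) /=; last first.
  by apply: uniq_perm; rewrite /= ?primes_uniq // pN pdN.
rewrite GE /= ?primes_uniq ?pN ?pdN // big_cons inE eqxx lognE p_pr N0 (negPf pdN).
by rewrite /=; lia.
Qed.

Lemma biglcmn_gt0 (I : eqType) (r : seq I) (F : I -> nat) :
  (forall i, i \in r -> 0 < F i)%N -> (0 < \big[lcmn/1]_(i <- r) F i)%N.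
Proof.
elim: r => [|i r IH] r0; first by rewrite big_nil.
rewrite big_cons lcmn_gt0 r0 ?mem_head // IH // => j jr.
by apply: r0; rewrite inE jr orbT.
Qed.

Lemma logn_biglcmn (I : eqType) (p : nat) (r : seq I) (F : I -> nat) :
  (forall i, i \in r -> 0 < F i)%N ->
  logn p (\big[lcmn/1%N]_(i <- r) F i) = (\max_(i <- r) logn p (F i))%N.
Proof.
elim: r => [|i r IH] r0; first by rewrite !big_nil logn1.
have r0' j : j \in r -> (0 < F j)%N by move=> jr; apply: r0; rewrite inE jr orbT.
by rewrite !big_cons logn_lcm ?r0 ?mem_head ?biglcmn_gt0 // IH.
Qed.

(** Only the valuation at p can change, and it does so exactly when that of n is at least that of R.
    In the application R is the lcm of the indices of the other lattices. *)
Lemma lcmn_mul_prime (p n R : nat) : prime p -> (0 < n)%N -> (0 < R)%N ->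
  lcmn (p * n) R =
  if (logn p R <= logn p n)%N then (p * lcmn n R)%N else lcmn n R.
Proof.
move=> p_pr n0 R0; have p0 := prime_gt0 p_pr.
have pn0 : (0 < p * n)%N by rewrite muln_gt0 p0.
apply: eqn_from_log => [||q]; first by rewrite lcmn_gt0 pn0.
  by case: ifP => _; rewrite ?muln_gt0 ?lcmn_gt0 ?p0 ?n0.
have lp : logn q p = (q == p) by apply: logn_prime.
rewrite logn_lcm // lognM // lp.
case: leqP => le_pR; rewrite ?lognM ?lcmn_gt0 ?n0 // logn_lcm // ?lp.
  by case: eqP => [->|_] //=; lia.
by case: eqP => [->|_] //=; lia.
Qed.

(** * Collections of lattices sharing no primitive vector *)

(* A vector is primitive if it occurs in a basis of Z^2, i.e. if some integral
   form takes the value 1 on it. *)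
Definition primitive_disjoint (C : {fset set Z2}) : Prop :=
  (forall L, L \in C -> is_lattice L /\ cocyclic L) /\
  (forall L M c z, L \in C -> M \in C -> form c z = 1 -> L z -> M z -> L = M).

Lemma cocyclic_index_gt0 (L : set Z2) : is_lattice L -> cocyclic L ->
  (0 < subgroup_index setT L)%N.
Proof.
move=> latL cocL; have [u [g [n [n0 ug ->]]]] := cocyclic_congr_lattice latL cocL.
by rewrite (index_congr_lattice_setT n0 ug).
Qed.

(** The basis vector on which the reduced form vanishes. It serves to keep descendants of one
    lattice apart from the other lattices. *)
Lemma cocyclic_primitive (L : set Z2) : is_lattice L -> cocyclic L ->
  exists c z, form c z = 1 /\ L z.
Proof.
move=> latL cocL; have [u [g [n [n0 ug ->]]]] := cocyclic_congr_lattice latL cocL.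
have [u' [v [e [f [_ ve [_ ue] _ ->]]]]] := congr_lattice_basis ug.
by exists v, e; split=> //; rewrite /congr_lattice /= ue dvdz0.
Qed.

Lemma cocyclic_eq (L M : set Z2) (c z : Z2) :
  is_lattice L -> cocyclic L -> is_lattice M -> cocyclic M ->
  subgroup_index setT L = subgroup_index setT M ->
  form c z = 1 -> L z -> M z -> L = M.
Proof.
move=> latL cocL latM cocM.
have [u [g [n [n0 ug ->]]]] := cocyclic_congr_lattice latL cocL.
have [v [h [m [m0 vh ->]]]] := cocyclic_congr_lattice latM cocM.
rewrite (index_congr_lattice_setT n0 ug) (index_congr_lattice_setT m0 vh).
move=> nm; rewrite -{}nm in vh * => cz Lz Mz.
by rewrite (congr_lattice_primitive cz ug Lz) (congr_lattice_primitive cz vh Mz).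
Qed.

Lemma descendant_index (p : nat) (L L' : set Z2) :
  is_lattice L -> cocyclic L -> (0 < p)%N -> descendants p L L' ->
  subgroup_index setT L' = (p * subgroup_index setT L)%N.
Proof.
move=> latL cocL p0; have n0 := cocyclic_index_gt0 latL cocL.
move=> /(descendants_congr_lattice _ latL.1 n0 p0)[w [g [wg -> _]]].
by rewrite [RHS]mulnC (index_congr_lattice_setT _ wg) // muln_gt0 n0.
Qed.

(** * The effect of one refinement step *)

(** Turns the set equation of a refinement into permutations of lists, from which cardinalities and
    lcms can be read off; this needs that no descendant is already present. *)
Lemma refinement_perm (p : nat) (L : set Z2) (C D : {fset set Z2}) :
  primitive_disjoint C -> is_p_refinement p L C D ->
  primitive_disjoint D /\
  exists ds r : seq (set Z2),
    [/\ perm_eq C (L :: r), perm_eq D (ds ++ r),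
        size ds = (p + ~~ (p %| subgroup_index setT L))%N &
        forall M, M \in ds ->
          subgroup_index setT M = (p * subgroup_index setT L)%N].
Proof.
move=> [coc disj] [p_pr LC DE]; have p0 := prime_gt0 p_pr.
have [latL cocL] := coc L LC.
have memD M : M \in D <-> (M \in C /\ M <> L) \/ descendants p L M.
  by have := congr1 (fun A : set (set Z2) => A M) DE; rewrite /= => ->.
have sub M : descendants p L M -> M `<=` L by case.
split.
  split=> [M /memD[[/coc]|[]]//|M M' c z /memD MD /memD MD' cz Mz M'z].
  (* A primitive vector of a descendant lies in [L], hence in no other old lattice; two descendants
     have equal index, so [cocyclic_eq] applies. *)
  case: MD MD' => [[MC ML]|dM] [[MC' ML']|dM'].
  - exact: disj cz Mz M'z.
  - by case: ML; apply: disj MC LC cz Mz (sub _ dM' _ M'z).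
  - by case: ML'; apply: disj MC' LC cz M'z (sub _ dM _ Mz).
  case: (dM) (dM') => latM cocM _ _ [latM' cocM' _ _].
  apply: (cocyclic_eq latM cocM latM' cocM' _ cz Mz M'z).
  by rewrite (descendant_index latL cocL p0 dM) (descendant_index latL cocL p0 dM').
have [ds [ds_uniq ds_size dsP]] := descendants_seq latL cocL p_pr.
exists ds, (rem L C); split=> //; first exact: perm_to_rem.
  apply: uniq_perm; first exact: fset_uniq.
    rewrite cat_uniq ds_uniq rem_uniq ?fset_uniq // andbT.
    apply/hasPn => M /=; rewrite mem_rem_uniq ?fset_uniq // inE => /andP[ML MC].
    apply/negP => /dsP dM; have [latM cocM _ _] := dM.
    have [c [z [cz Mz]]] := cocyclic_primitive latM cocM.
    by case/eqP: ML; apply: disj MC LC cz Mz (sub _ dM _ Mz).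
  move=> M; rewrite mem_cat mem_rem_uniq ?fset_uniq // inE.
  apply/idP/orP => [/memD[[MC /eqP ML]|/dsP]|[/dsP dM|/andP[/eqP ML MC]]].
  - by right; rewrite ML.
  - by left.
  - by apply/memD; right.
  by apply/memD; left.
by move=> M /dsP; apply: descendant_index.
Qed.

(** In the maximal case cardinality minus [G] of the lcm is unchanged, written additively to avoid
    truncated subtraction. *)
Lemma refinement_size (p : nat) (L : set Z2) (C D : {fset set Z2}) :
  primitive_disjoint C -> is_p_refinement p L C D ->
  (maximal_step (C, p, L) /\
     (#|` D| + G (lcm_index C) = #|` C| + G (lcm_index D))%N) \/
  (~ maximal_step (C, p, L) /\
     (#|` D| > #|` C|)%N /\ lcm_index D = lcm_index C).
Proof.
move=> dC ref; have [dD [ds [r [permC permD ds_size ds_idx]]]] := refinement_perm dC ref.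
have [p_pr LC _] := ref; have p0 := prime_gt0 p_pr.
have idx0 M : M \in C -> (0 < subgroup_index setT M)%N.
  by move=> /(dC.1 _)[]; apply: cocyclic_index_gt0.
have r0 M : M \in r -> (0 < subgroup_index setT M)%N.
  by move=> Mr; apply: idx0; rewrite (perm_mem permC) inE Mr orbT.
move: (idx0 L LC) ds_size ds_idx.
set n := subgroup_index setT L => n0 ds_size ds_idx.
pose R := (\big[lcmn/1]_(M <- r) subgroup_index setT M)%N.
have R0 : (0 < R)%N by apply: biglcmn_gt0.
have lcmC : lcm_index C = lcmn n R by rewrite /lcm_index (perm_big _ permC) big_cons.
have lcmD : lcm_index D = lcmn (p * n) R.
  rewrite /lcm_index (perm_big _ permD) big_cat /=; congr lcmn.
  (* The lcm over an empty list would be 1 instead of p n. *)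
  have : ds != [::] by rewrite -size_eq0 ds_size; lia.
  elim: (ds) ds_idx => // M s IH sE _.
  rewrite big_cons sE ?mem_head //; case: s IH sE => [|M' s] IH sE.
    by rewrite big_nil lcmn1.
  rewrite IH ?(lcmn_idPl (dvdnn _)) // => M'' sM''.
  by rewrite sE // inE sM'' orbT.
have szC : #|` C| = (size r).+1 by rewrite (perm_size permC).
have szD : #|` D| = (p + ~~ (p %| n) + size r)%N.
  by rewrite (perm_size permD) size_cat ds_size.
have maxE : maximal_step (C, p, L) <-> (logn p R <= logn p n)%N.
  rewrite /maximal_step (perm_big _ permC) big_cons -/n -logn_biglcmn // -/R.
  by split=> [E|le_pR]; [apply/maxn_idPl|apply/esym/maxn_idPl].
rewrite lcmC lcmD szC szD maxE lcmn_mul_prime //.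
case: ifP => le_pR; last first.
  by right; split=> //; split=> //; have := prime_gt1 p_pr; lia.
left; split=> //; rewrite G_mul_prime ?lcmn_gt0 ?n0 //.
(* By maximality p is new to the lcm exactly when it is new to n, so the extra 1 in [G] matches the
   extra descendant. *)
have -> : (p %| lcmn n R)%N = (p %| n)%N.
  have dvdE m : (0 < m)%N -> (p %| m)%N = (0 < logn p m)%N.
    by move=> m0; rewrite logn_gt0 mem_primes p_pr m0.
  by rewrite !dvdE ?lcmn_gt0 ?n0 // logn_lcm // (maxn_idPl le_pR).
by case: (p %| n)%N => /=; lia.
Qed.

(** * Induction along a construction *)

(** The excess of the cardinality over [G] of the lcm starts at 1, is kept by maximal steps and
    strictly raised by all others, so once above 1 it never returns. *)
Lemma construction_size (s : seq step) (C : {fset set Z2}) :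
  construction trivial_covering s C ->
  [/\ primitive_disjoint C, (1 + G (lcm_index C) <= #|` C|)%N &
      #|` C| = (1 + G (lcm_index C))%N <-> forall t, t \in s -> maximal_step t].
Proof.
elim=> [|{}s D p L D' _ [dD leD eqD] ref].
  (* Z^2 is the congruence lattice of modulus 1, which yields its index and cocyclicity. *)
  have T1 := congr_lattice1 (1, 0).
  have h1 : (1%N %| form (1, 0) (0 : Z2)%R - 1)%Z by apply: dvd1z.
  have coc : is_lattice setT /\ cocyclic setT.
    rewrite -T1; split; first exact: (congr_lattice_is_lattice (n := 1) _ h1).
    exact: congr_lattice_cocyclic h1.
  have idx1 : subgroup_index setT setT = 1%N.
    by rewrite -{2}T1; exact: (index_congr_lattice_setT (n := 1) _ h1).
  have E : lcm_index trivial_covering = 1%N.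
    by rewrite /lcm_index /trivial_covering big_seq_fset1 idx1.
  have G1 : G 1 = 0%N by rewrite /G big_nil.
  rewrite E G1 /trivial_covering cardfs1; split=> //.
  by split=> [L /fset1P->|L M c z /fset1P-> /fset1P->].
have [dD' _] := refinement_perm dD ref; split=> //.
  by case: (refinement_size dD ref) => -[_ E]; [lia|case: E => E ->; lia].
have splitP : (forall t, t \in rcons s (D, p, L) -> maximal_step t) <->
    maximal_step (D, p, L) /\ forall t, t \in s -> maximal_step t.
  split=> [all_max|[maxL all_max] t].
    by split=> [|t ts]; apply: all_max; rewrite mem_rcons inE ?eqxx ?ts ?orbT.
  by rewrite mem_rcons inE => /orP[/eqP ->|/all_max].
rewrite splitP -eqD; case: (refinement_size dD ref) => -[maxL E].
  by split=> [DE|[_ DE]]; [split=> //|]; lia.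
by case: E => E E'; split=> [|[]//]; rewrite E'; lia.
Qed.

Theorem theorem5p7 (C : {fset set Z2}) :
  is_covering C -> is_refinement trivial_covering C ->
  (1 + G (lcm_index C) <= #|` C|)%N /\
  (forall s : seq step, construction trivial_covering s C ->
     (#|` C| = (1 + G (lcm_index C))%N <-> forall t, t \in s -> maximal_step t)).
Proof.
move=> _ [s0 constr0]; split; first by have [] := construction_size constr0.
by move=> s /construction_size[].
Qed.
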